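(* Let $X, Y, Z, K, J$ be as in the context (so that $K\colon Z\to Y$ is a bounded linear operator between real Hilbert spaces with adjoint $K^*\colon Y\to Z$, and $J\colon Z\to\mathbb{R}\cup\{\infty\}$ is the regularisation functional), let $u^\dagger\in X$ with $J(u^\dagger)<\infty$, and define $G_J\colon Y\to\mathbb{R}$ by $$G_J(v)=B_J\left(u^\dagger,\,u^\dagger+K^* v\right),$$ where $B_J$ is the Bregman loss $$B_J(u,p)=\left(\tfrac12\|\cdot\|^2+J\right)(u)+\left(\tfrac12\|\cdot\|^2+J\right)^\star(p)-\langle p,u\rangle .$$ Then: (i) If there exists $v\in Y$ which satisfies the source condition $K^* v\in\partial J(u^\dagger)$, then such $v$ is a global minimiser of $G_J$. (ii) Vice versa, if $v\in Y$ is a global minimiser of $G_J$, then it satisfies $$K u^\dagger=K\operatorname{prox}_J\left(u^\dagger+K^* v\right),$$ and this identity implies the source condition $K^* v\in\partial J(u^\dagger)$ if $K$ has only a trivial null space.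
   Context: All spaces are real. Standing assumptions: (1) $Y$ is a Hilbert space. (2) $X$ is the dual of a normed space $\mathcal{X}$ such that the weak-star topology on $X$ is metrisable on bounded sets. (3) The forward operator $K\colon X\to Y$ is bounded and linear and is the adjoint of a bounded linear operator from $Y$ to $\mathcal{X}$. (4) $J\colon X\to\mathbb{R}\cup\{\infty\}$ is non-negative and is the convex conjugate of a proper functional from $\mathcal{X}$ to $\mathbb{R}\cup\{\infty\}$ (in particular $J$ is convex). (5) For every $f\in Y$ and $\alpha>0$ there exists a constant $c=c(a,b,\|f\|)$, depending monotonically non-decreasingly on all arguments, such that $\|u\|_X\le c$ whenever $\|Ku-f\|\le a$ and $J(u)\le b$. Hilbert space extension: $X$ is continuously embedded into a Hilbert space $Z$ with inner product $\langle\cdot,\cdot\rangle$ and norm $\|\cdot\|$. The operator $K$ is extended to a bounded linear operator $Z\to Y$, still denoted $K$, with Hilbert space adjoint $K^*\colon Y\to Z$ ($Y$ and $Z$ are identified with their duals by the Riesz theorem). The functional $J$ is extended to $Z$ by setting $J=\infty$ on $Z\setminus X$, and this extension, still denoted $J\colon Z\to\mathbb{R}\cup\{\infty\}$, is proper, convex and lower semicontinuous on $Z$. Subdifferential: for $\hat u\in Z$ with $J(\hat u)<\infty$, $\partial J(\hat u)=\{x^*\in Z : J(u)-J(\hat u)\ge\langle x^*,u-\hat u\rangle \text{ for all } u\in Z\}$. Convex conjugate: for $F\colon Z\to\mathbb{R}\cup\{\infty\}$, $F^\star(p)=\sup_{u\in Z}\{\langle p,u\rangle-F(u)\}$ for $p\in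 Z$. Proximal map: for a proper, convex, lower semicontinuous functional $F$ on $Z$, $\operatorname{prox}_F\colon Z\to Z$ is defined by $\operatorname{prox}_F(z)=\operatorname{arg\,min}_{u\in Z}\left\{\tfrac12\|u-z\|^2+F(u)\right\}$. *)

(* Defs.v *)
From HB Require Import structures.
From mathcomp Require Import all_boot all_order all_algebra.
From mathcomp Require Import all_classical all_reals all_analysis.
From mathcomp Require Import lra.

Set Implicit Arguments.
Unset Strict Implicit.
Unset Printing Implicit Defensive.

Import Order.TTheory GRing.Theory Num.Theory.
Import numFieldNormedType.Exports.

Local Open Scope classical_set_scope.
Local Open Scope ring_scope.

(* Real Hilbert spaces: the norm of a complete normed space comes from an
   inner product. *)
HB.mixin Record isHilbert (R : realType) H & CompleteNormedModule R H := {
  inner : {dot H for @idfun R} ;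
  innerE : forall x : H, inner x x = `|x| ^+ 2
}.

#[short(type="hilbertType")]
HB.structure Definition Hilbert (R : realType) :=
  { H of CompleteNormedModule R H & isHilbert R H }.

Notation "''<' u , v >" := (inner u v)
  (at level 2, u at level 10, v at level 10, format "''<' u ,  v >").

Definition bounded_op (R : realType) (V W : normedModType R) (f : V -> W) :=
  exists C : R, forall x, `|f x| <= C * `|x|.

(* The topological dual, with the operator norm. *)
Section dual.
Context (R : realType) (E : normedModType R).

Definition dual_pred : {pred E -> R^o} :=
  fun f => `[< linear f /\ bounded_op f >].

Record dual := Dual { dual_fun :> E -> R^o ; dualP : dual_fun \in dual_pred }.

HB.instance Definition _ := [isSub for dual_fun].
HB.instance Definition _ := [Choice of dual by <:].

Lemma dual_submod_closed : submod_closed dual_pred.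
Proof.
split=> [|a f g /asboolP[fl [C fC]] /asboolP[gl [D gD]]]; apply/asboolP.
  have fun0E x : (0 : E -> R^o) x = 0 by [].
  split; first by move=> a x y; rewrite !fun0E scaler0 addr0.
  by exists 0 => x; rewrite fun0E normr0 mul0r.
have funE x : (a *: f + g) x = a *: f x + g x by [].
split.
  move=> b x y; rewrite !funE fl gl !scalerDr !scalerA [a * b]mulrC.
  by rewrite addrACA.
exists (`|a| * C + D) => x; rewrite funE mulrDl.
apply: (le_trans (ler_normD _ _)); apply: lerD => //.
by rewrite normrZ -mulrA ler_wpM2l.
Qed.

HB.instance Definition _ :=
  GRing.isSubmodClosed.Build R (E -> R^o) dual_pred dual_submod_closed.
HB.instance Definition _ := [SubChoice_isSubLmodule of dual by <:].

Definition dual_norm (f : dual) : R :=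
  sup [set `|f x| | x in [set x : E | `|x| <= 1]].

Lemma dual_linear (f : dual) : linear f.
Proof. by have /asboolP[] := dualP f. Qed.

Lemma dual_bounded (f : dual) : bounded_op f.
Proof. by have /asboolP[] := dualP f. Qed.

Lemma dualZ (f : dual) a x : f (a *: x) = a * f x.
Proof.
have f0 : f 0 = 0.
  by have := dual_linear f (-1) 0 0; rewrite scaler0 addr0 scaleN1r addNr.
by have := dual_linear f a x 0; rewrite !addr0 f0 addr0.
Qed.

Lemma dual_has_sup (f : dual) :
  has_sup [set `|f x| | x in [set x : E | `|x| <= 1]].
Proof.
split; first by exists `|f 0|; exists 0 => //=; rewrite normr0.
have [C fC] := dual_bounded f; exists `|C| => _ [x /= x1 <-].
apply: (le_trans (fC x)); apply: (le_trans (ler_norm _)).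
by rewrite normrM normr_id ler_piMr.
Qed.

Lemma ler_dual_norm (f : dual) x : `|f x| <= dual_norm f * `|x|.
Proof.
have [->|x0] := eqVneq x 0.
  by have := dualZ f 0 0; rewrite scale0r mul0r => ->; rewrite !normr0 mulr0.
rewrite -ler_pdivrMr ?normr_gt0//.
apply: (ub_le_sup (proj2 (dual_has_sup f))).
exists (`|x|^-1 *: x) => /=.
  by rewrite normrZ normfV normr_id mulVf// normr_eq0.
by rewrite dualZ normrM normfV normr_id mulrC.
Qed.

Lemma dual_norm_le (f : dual) M :
  (forall x, `|x| <= 1 -> `|f x| <= M) -> dual_norm f <= M.
Proof.
move=> fM; apply: ge_sup; first exact: (proj1 (dual_has_sup f)).
by move=> _ [x /= x1 <-]; exact: fM.
Qed.

Lemma dual_norm_ge0 (f : dual) : 0 <= dual_norm f.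
Proof.
apply: le_trans (normr_ge0 (f 0)) _.
by apply: (ub_le_sup (proj2 (dual_has_sup f))); exists 0 => //=; rewrite normr0.
Qed.

Lemma dual_normD (f g : dual) : dual_norm (f + g) <= dual_norm f + dual_norm g.
Proof.
apply: dual_norm_le => x x1; apply: (le_trans (ler_normD _ _)).
by apply: lerD; apply: (le_trans (ler_dual_norm _ _));
  rewrite ler_piMr// dual_norm_ge0.
Qed.

Lemma dual_normZ (a : R) (f : dual) : dual_norm (a *: f) = `|a| * dual_norm f.
Proof.
have le b (g : dual) : dual_norm (b *: g) <= `|b| * dual_norm g.
  apply: dual_norm_le => x x1; rewrite normrZ ler_wpM2l//.
  by apply: (le_trans (ler_dual_norm _ _)); rewrite ler_piMr// dual_norm_ge0.
apply/eqP; rewrite eq_le le/=.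
have [->|a0] := eqVneq a 0; first by rewrite normr0 mul0r dual_norm_ge0.
rewrite -ler_pdivlMl ?normr_gt0// -normfV.
by have := le a^-1 (a *: f); rewrite scalerA mulVf// scale1r.
Qed.

Lemma dual_norm0_eq0 (f : dual) : dual_norm f = 0 -> f = 0.
Proof.
move=> f0; apply/val_inj/funext => x /=.
by apply/eqP; rewrite -normr_le0 (le_trans (ler_dual_norm f x))// f0 mul0r.
Qed.

HB.instance Definition _ :=
  Lmodule_isNormed.Build R dual dual_normD dual_normZ dual_norm0_eq0.

(* The weak-star topology is the one induced by pointwise convergence. *)
Definition weak_star :=
  initial_topology (fun f : dual => (f : {ptws E -> R^o})).
HB.instance Definition _ := Topological.on weak_star.

End dual.

(* [B], with the subspace topology, is metrisable. *)
Definition metrizable_on (R : realType) (T : topologicalType) (B : set T) :=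
  exists d : T -> T -> R,
  [/\ {in B &, forall x y, 0 <= d x y /\ (d x y = 0 <-> x = y)},
      {in B &, forall x y, d x y = d y x},
      {in B & &, forall x y z, d x z <= d x y + d y z} &
      forall x A, B x ->
        within B (nbhs x) A <->
        exists2 e, 0 < e & B `&` [set y | d x y < e] `<=` A].

Definition argmin (T : Type) (disp : Order.disp_t) (S : porderType disp)
  (f : T -> S) : set T := [set x | forall y, (f x <= f y)%O].

Section extended_functionals.
Context (R : realType).
Local Open Scope ereal_scope.

Definition proper_fun (T : Type) (F : T -> \bar R) :=
  (exists x, F x < +oo) /\ (forall x, -oo < F x).

Definition convex_efun (V : lmodType R) (F : V -> \bar R) :=
  forall (t : R) (x y : V), (0 <= t <= 1)%R ->
    F (t *: x + (1 - t) *: y)%R <= t%:E * F x + (1 - t)%:E * F y.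

Definition conjugate (T S : Type) (dp : S -> T -> R) (F : T -> \bar R) (p : S) :=
  ereal_sup (range (fun u => (dp p u)%:E - F u)).

Context (Z : hilbertType R).
Implicit Types (F J : Z -> \bar R) (u p z : Z).

(* Meaningful only at points where [J] is finite. *)
Definition subdifferential J u : set Z :=
  [set p | forall w, ('<p, (w - u)%R>)%:E <= J w - J u].

(* For proper convex lsc [F] the minimiser exists and is unique; [0] is a
   default value. *)
Definition prox F z : Z :=
  xget 0%R (argmin (fun u => (2^-1 * `|u - z| ^+ 2)%:E + F u)).

Definition half_sqnorm_plus J u := (2^-1 * `|u| ^+ 2)%:E + J u.

Definition bregman_loss J u p :=
  half_sqnorm_plus J u
  + conjugate (fun p u => '<p, u>) (half_sqnorm_plus J) p - ('<p, u>)%:E.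

(* [fine] is harmless here: see [source_lossE]. *)
Definition source_loss (Y : Type) (Kstar : Y -> Z) J u (v : Y) : R :=
  fine (bregman_loss J u (u + Kstar v)%R).

Lemma bregman_loss_fin_num J u p : (forall w, 0 <= J w) -> J u < +oo ->
  bregman_loss J u p \is a fin_num.
Proof.
move=> J0 Ju.
have Jufin : J u \is a fin_num by rewrite ge0_fin_numE.
rewrite /bregman_loss fin_numB fin_numD andbT.
rewrite {1}/half_sqnorm_plus fin_numD Jufin/=.
rewrite fin_numElt; apply/andP; split.
  apply: (@lt_le_trans _ _ (('<p, u>)%:E - half_sqnorm_plus J u)); last first.
    by apply: ereal_sup_ubound; exists u.
  by rewrite /half_sqnorm_plus -(fineK Jufin); exact: ltNyr.
apply: (@le_lt_trans _ _ (2^-1 * `|p| ^+ 2)%:E); last exact: ltry.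
apply: ge_ereal_sup => _ [w _ <-]; rewrite /half_sqnorm_plus.
apply: (@le_trans _ _ (('<p, w>)%:E - (2^-1 * `|w| ^+ 2)%:E)).
  by rewrite leeB// leeDl.
rewrite -EFinB lee_fin.
have := sqr_ge0 `|p - w|%R; rewrite -!innerE.
rewrite linearBl/= !linearBr/= (hermC _ w p) /= expr0 mul1r.
lra.
Qed.

Lemma source_lossE (Y : Type) (Kstar : Y -> Z) J u v :
  (forall w, 0 <= J w) -> J u < +oo ->
  (source_loss Kstar J u v)%:E = bregman_loss J u (u + Kstar v)%R.
Proof. by move=> J0 Ju; rewrite fineK// bregman_loss_fin_num. Qed.

End extended_functionals.

(* Main.v *)
(** Set [H := |.|^2 / 2 + J], so that [G v = H u + H^* p - <p, u>] with
    [p := u + K^* v].  By the Fenchel-Young inequality [G >= 0], and [G v = 0]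
    when [K^* v] is a subgradient of [J] at [u]; hence (i).  For
    [x := prox J p] the optimality condition reads: [p - x] is a subgradient of
    [J] at [x].  It gives the descent inequality
    [H^* (p + h) <= H^* p + <h, x> + |h|^2 / 2].  With [h := - t K^* d] and
    [d := K (x - u)], minimality of [v] forces
    [t |d|^2 <= t^2 |K^* d|^2 / 2] for small [t > 0], so [d = 0].  If [K] is
    injective then [x = u], and the optimality condition at [x] is the source
    condition. *)
Require Import Defs.
From HB Require Import structures.
From mathcomp Require Import all_boot all_order all_algebra.
From mathcomp Require Import all_classical all_reals all_analysis.
From mathcomp Require Import ring lra.

Set Implicit Arguments.
Unset Strict Implicit.
Unset Printing Implicit Defensive.

Import Order.TTheory GRing.Theory Num.Theory.
Import numFieldNormedType.Exports.

Local Open Scope classical_set_scope.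
Local Open Scope ring_scope.

(** Stands in for the limit [t -> 0] in first-order variation arguments. *)
Lemma ler_affine_right0 (R : realFieldType) (a b c : R) :
  (forall t, 0 < t <= 1 -> a <= b + t * c) -> a <= b.
Proof.
move=> abc; apply/ler_addgt0Pr => e e0.
(* Chosen so that [s * (e + |c|) = e], hence [s * c <= e]; the summand [e] keeps the denominator
   positive when [c = 0]. *)
pose s := e / (e + `|c|).
have ec : 0 < e + `|c| by rewrite ltr_wpDr.
have s01 : 0 < s <= 1.
  by rewrite divr_gt0//= ler_pdivrMr// mul1r lerDl.
apply: (le_trans (abc _ s01)); rewrite lerD2l.
have /andP[s0 _] := s01.
apply: (@le_trans _ _ (s * (e + `|c|))); last by rewrite divfK// gt_eqF.
by rewrite ler_pM2l// (le_trans (ler_norm c))// lerDr ltW.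
Qed.

Section inner_product.
Context (R : realType) (H : hilbertType R).
Implicit Types u v w : H.

Lemma innerC u v : '<u, v> = '<v, u>.
Proof. by rewrite hermC /= expr0 mul1r. Qed.

Lemma innerDl u v w : '<(u + v), w> = '<u, w> + '<v, w>.
Proof. by rewrite linearDl. Qed.

Lemma innerZl a u v : '<(a *: u), v> = a * '<u, v>.
Proof. by rewrite linearZl_LR. Qed.

Lemma innerNl u v : '<(- u), v> = - '<u, v>.
Proof. by rewrite linearNl. Qed.

Lemma innerDr u v w : '<u, (v + w)> = '<u, v> + '<u, w>.
Proof. by rewrite linearDr. Qed.

Lemma innerNr u v : '<u, (- v)> = - '<u, v>.
Proof. by rewrite linearNr. Qed.

Lemma innerZr a u v : '<u, (a *: v)> = a * '<u, v>.
Proof. by rewrite innerC innerZl innerC. Qed.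

Definition inner_expand := (innerDl, innerDr, innerNl, innerNr, innerZl, innerZr).

Lemma inner_ge0 u : 0 <= '<u, u>.
Proof. by rewrite innerE sqr_ge0. Qed.

End inner_product.

Lemma convex_efun_fin (R : realType) (V : lmodType R) (F : V -> \bar R)
    (t a b : R) (u w : V) : convex_efun F -> 0 <= t <= 1 ->
  F u = a%:E -> F w = b%:E ->
  (F (t *: u + (1 - t) *: w)%R <= (t * a + (1 - t) * b)%:E)%E.
Proof. by move=> Fc t01 Fu Fw; rewrite (le_trans (Fc _ _ _ t01))// Fu Fw. Qed.

Lemma nneg_lty_fin (R : realType) (T : Type) (F : T -> \bar R) u :
  (forall w, 0 <= F w)%E -> (F u < +oo)%E -> exists a, F u = a%:E.
Proof. by move=> F0 Fu; exists (fine (F u)); rewrite fineK// ge0_fin_numE. Qed.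

(** * Existence of proximal points and their optimality condition *)

Section proximal_point.
Context (R : realType) (Z : hilbertType R) (F : Z -> \bar R).
Hypotheses (F_ge0 : forall w, (0 <= F w)%E) (F_convex : convex_efun F).
Implicit Types u w x z : Z.

Let phi z u : \bar R := ((2^-1 * `|u - z| ^+ 2)%:E + F u)%E.

(* A minimising sequence is Cauchy by the parallelogram law and the convexity
   of [F]; lower semicontinuity makes its limit a minimiser. *)
Lemma argmin_prox_nonempty z : proper_fun F -> lower_semicontinuous F ->
  argmin (phi z) !=set0.
Proof.
move=> [[u0 Fu0] _] F_lsc.
(* The finite values of [phi z]; with the square moved across, membership forces [F u] to be
   finite. *)
pose E := [set r | exists u, F u = (r - 2^-1 * `|u - z| ^+ 2)%:E].
have E_ge0 : lbound E 0.
  move=> r [u Fu]; have := F_ge0 u; rewrite Fu lee_fin subr_ge0.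
  by apply: le_trans; rewrite mulr_ge0 ?invr_ge0 ?sqr_ge0.
have [a0 Fa0] := nneg_lty_fin F_ge0 Fu0.
have E_inf : has_inf E.
  split; last by exists 0.
  by exists (a0 + 2^-1 * `|u0 - z| ^+ 2), u0; rewrite Fa0 addrK.
pose m := inf E.
have m_le u a : F u = a%:E -> m <= a + 2^-1 * `|u - z| ^+ 2.
  move=> Fu; apply: (ge_inf (proj2 E_inf)).
  by exists u; rewrite Fu addrK.
have /choice[s sP] : forall n, exists ua : Z * R,
    F ua.1 = ua.2%:E /\ ua.2 + 2^-1 * `|ua.1 - z| ^+ 2 < m + n.+1%:R^-1.
  move=> n; have n0 : 0 < n.+1%:R^-1 :> R by [].
  have [r [u Fu] rm] := inf_adherent n0 E_inf.
  by exists (u, r - 2^-1 * `|u - z| ^+ 2); rewrite subrK.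
(* At the midpoint [phi z] is at least [m] and at most the mean of the two values minus
   [|s_i - s_j|^2 / 8], whence the factor 8. *)
have sq_dist e i j : i.+1%:R^-1 < e -> j.+1%:R^-1 < e ->
    `|(s i).1 - (s j).1| ^+ 2 <= 8 * e.
  move=> ie je; have [[Fi si] [Fj sj]] := (sP i, sP j).
  have h01 : 0 <= (2^-1 : R) <= 1 by apply/andP; split; lra.
  have Fm := convex_efun_fin F_convex h01 Fi Fj.
  have [c Fc] := nneg_lty_fin F_ge0 (le_lt_trans Fm (ltry _)).
  have := m_le _ _ Fc; rewrite Fc lee_fin in Fm.
  move: si sj; rewrite -!innerE !inner_expand.
  rewrite (innerC z (s i).1) (innerC z (s j).1) (innerC (s j).1 (s i).1).
  by move: Fm ie je; move: (i.+1%:R^-1) (j.+1%:R^-1) => ei ej; lra.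
pose x := lim ((s n).1 @[n --> \oo]).
have sx : (s n).1 @[n --> \oo] --> x.
  apply/cauchy_cvgP/cauchy_exP => e e0.
  have e16 : 0 < e ^+ 2 / 16 by rewrite divr_gt0// exprn_gt0.
  have near_small : \forall n \near \oo, n.+1%:R^-1 < e ^+ 2 / 16.
    exact: (near_infty_natSinv_lt (PosNum e16)).
  have [N _ smallN] := near_small.
  exists (s N).1; exists N => // n Nn; rewrite -ball_normE /=.
  rewrite -(ltr_pXn2r (ltn0Sn 1)) ?nnegrE ?(ltW e0)//.
  apply: (le_lt_trans (sq_dist _ _ _ (smallN _ (leqnn N)) (smallN _ Nn))).
  by have := exprn_gt0 2 e0; lra.
(* Any [a] strictly below [F x] is eventually below [F (s n).1]; the bound then passes to the limit,
   and this also covers [F x = +oo]. *)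
have F_le a : (a%:E < F x)%E -> a + 2^-1 * `|x - z| ^+ 2 <= m.
  move=> /F_lsc[W Wx aW].
  have nearW := sx W Wx.
  apply: (@ler_cvg_to _ \oo _ R (fun n => a + 2^-1 * `|(s n).1 - z| ^+ 2)
            (fun n => m + n.+1%:R^-1)).
  - apply: cvgD; first exact: cvg_cst.
    apply: cvgM; first exact: cvg_cst.
    apply: (@cvg_comp _ _ _ _ (fun r : R => r ^+ 2)); last exact: exprn_continuous.
    apply: cvg_norm; apply: cvgB => //; exact: cvg_cst.
  - rewrite -[X in _ --> X]addr0; apply: cvgD; first exact: cvg_cst.
    exact: cvg_harmonic.
  - near=> n; have [Fn sn] := sP n.
    have : (a%:E < F (s n).1)%E by apply: aW; near: n; exact: nearW.
    by rewrite Fn lte_fin; move: sn; move: (n.+1%:R^-1) => en /=; lra.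
have Fx_le : (phi z x <= m%:E)%E.
  rewrite /phi; case Fx : (F x) => [r| |].
  - rewrite -EFinD lee_fin; apply/ler_addgt0Pr => e e0.
    have := F_le (r - e); rewrite Fx lte_fin; lra.
  (* If [F x = +oo], the choice [a = m + 1] would give [m + 1 <= m]. *)
  - exfalso; have := F_le (m + 1); rewrite Fx ltry => /(_ isT).
    by have := sqr_ge0 (`|x - z|); lra.
  - by have := F_ge0 x; rewrite Fx.
exists x => w; apply: (le_trans Fx_le); rewrite /phi.
case Fw : (F w) => [r| |].
- by rewrite -EFinD lee_fin addrC m_le.
- by rewrite addey// leey.
- by have := F_ge0 w; rewrite Fw.
Unshelve. all: by end_near.
Qed.

(** Existence of a minimiser rules out the default value in [prox]. *)
Lemma proxP z : proper_fun F -> lower_semicontinuous F ->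
  argmin (phi z) (prox F z).
Proof. by move=> Fp Fl; apply: xgetPex; exact: argmin_prox_nonempty. Qed.

Lemma argmin_prox_lty z x : proper_fun F -> argmin (phi z) x -> (F x < +oo)%E.
Proof.
move=> [[u Fu] _] /(_ u); rewrite /phi.
have [a ->] := nneg_lty_fin F_ge0 Fu.
by move=> /le_lt_trans => /(_ _ (ltry _)); case: (F x) => [r _| |]//; exact: ltry.
Qed.

(** Compare [x] with [t w + (1 - t) x], bound [F] there by convexity, divide by [t] and let [t] tend
    to 0. *)
Lemma argmin_prox_subdifferential z x : proper_fun F -> argmin (phi z) x ->
  subdifferential F x (z - x).
Proof.
move=> Fp xmin w.
have [a Fx] := nneg_lty_fin F_ge0 (argmin_prox_lty Fp xmin).
case Fw : (F w) => [b| |].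
- rewrite Fx -EFinB lee_fin.
  apply: (@ler_affine_right0 _ _ _ (2^-1 * `|w - x| ^+ 2)) => t /andP[t0 t1].
  have t01 : 0 <= t <= 1 by rewrite ltW.
  have Ft := convex_efun_fin F_convex t01 Fw Fx.
  have [c Fc] := nneg_lty_fin F_ge0 (le_lt_trans Ft (ltry _)).
  rewrite Fc lee_fin in Ft.
  have := xmin (t *: w + (1 - t) *: x).
  rewrite /phi Fc Fx -!EFinD lee_fin => le_t.
  rewrite -(ler_pM2l t0).
  move: Ft le_t; rewrite -!innerE !inner_expand.
  rewrite (innerC x w) (innerC z w) (innerC z x).
  nra.
- by rewrite Fx leey.
- by have := F_ge0 w; rewrite Fw.
Qed.

End proximal_point.

(** * The conjugate of [|.|^2 / 2 + F] and the Fenchel-Young inequality *)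

Section bregman_loss.
Context (R : realType) (Z : hilbertType R) (F : Z -> \bar R).
Hypothesis F_ge0 : forall w, (0 <= F w)%E.
Implicit Types h p u x : Z.

Let conj := conjugate (fun p u : Z => '<p, u>) (half_sqnorm_plus F).

(* The hypothesis says [x = prox F p], and the bound that [x] is the gradient of
   the conjugate at [p]. *)
Lemma conjugate_half_sqnorm_le p h x a :
  subdifferential F x (p - x) -> F x = a%:E ->
  (conj (p + h)%R <=
     ('<p, x> - (2^-1 * `|x| ^+ 2 + a) + '<h, x> + 2^-1 * `|h| ^+ 2)%:E)%E.
Proof.
move=> px Fx; apply: ge_ereal_sup => _ [w _ <-]; rewrite /half_sqnorm_plus.
case Fw : (F w) => [b| |].
- have := px w; rewrite Fx Fw -EFinD -!EFinB !lee_fin.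
  (* Once [b] is bounded below by the subgradient inequality, the two sides differ by exactly half
     of this square. *)
  have := inner_ge0 (w - x - h); rewrite -!innerE !inner_expand.
  rewrite (innerC x w) (innerC h w) (innerC h x).
  by move=> *; lra.
- by rewrite addey// leNye.
- by have := F_ge0 w; rewrite Fw.
Qed.

(** The upper bound is the descent inequality at [h = 0]; the lower bound tests the supremum at
    [x]. *)
Lemma conjugate_half_sqnormE p x a :
  subdifferential F x (p - x) -> F x = a%:E ->
  conj p = ('<p, x> - (2^-1 * `|x| ^+ 2 + a))%:E.
Proof.
move=> px Fx; apply/eqP; rewrite eq_le; apply/andP; split.
  have := conjugate_half_sqnorm_le 0 px Fx.
  by rewrite addr0 normr0 expr0n mulr0 linear0l !addr0.
by apply: ereal_sup_ubound; exists x; rewrite // /half_sqnorm_plus Fx.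
Qed.

Lemma bregman_loss_ge0 u p : (F u < +oo)%E -> (0 <= bregman_loss F u p)%E.
Proof.
move=> /(nneg_lty_fin F_ge0)[b Fu].
have : (('<p, u>)%:E - half_sqnorm_plus F u <= conj p)%E.
  by apply: ereal_sup_ubound; exists u.
rewrite /bregman_loss -/(conj p) /half_sqnorm_plus Fu -!EFinD.
case: (conj p) => [c| |] //; first by rewrite -!EFinD !lee_fin; lra.
by move=> _; rewrite addey// addye// leey.
Qed.

End bregman_loss.

(** * The loss [G] as a function of the source element *)

Section source_loss.
Context (R : realType) (Z : hilbertType R) (J : Z -> \bar R) (u : Z).
Hypotheses (J_ge0 : forall w, (0 <= J w)%E) (Ju_lty : (J u < +oo)%E).
Context (Y : hilbertType R) (Kstar : {linear Y -> Z}).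
Implicit Types (v w : Y) (x : Z).

Lemma source_loss_ge0 v : 0 <= source_loss Kstar J u v.
Proof. by rewrite -lee_fin source_lossE// bregman_loss_ge0. Qed.

Lemma source_loss_eq0 v :
  subdifferential J u (Kstar v) -> source_loss Kstar J u v = 0.
Proof.
move=> uv; apply: EFin_inj; rewrite source_lossE// /bregman_loss.
have [b Ju] := nneg_lty_fin J_ge0 Ju_lty.
(* The source condition is the optimality condition for [u] itself to be the proximal point of
   [u + Kstar v], so Fenchel-Young is an equality. *)
have uv' : subdifferential J u (u + Kstar v - u) by rewrite addrC addKr.
rewrite (conjugate_half_sqnormE J_ge0 uv' Ju) /half_sqnorm_plus Ju.
by rewrite -!EFinD; congr EFin; ring.
Qed.

(** The descent inequality with [h = Kstar w]; the term [- <p, u>] of the loss turns its slope [x]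
    into [x - u]. *)
Lemma source_loss_le v w x : (J x < +oo)%E ->
  subdifferential J x (u + Kstar v - x) ->
  source_loss Kstar J u (v + w) <=
    source_loss Kstar J u v + '<(Kstar w), (x - u)>
    + 2^-1 * `|Kstar w| ^+ 2.
Proof.
move=> /(nneg_lty_fin J_ge0)[a Jx] xv.
have [b Ju] := nneg_lty_fin J_ge0 Ju_lty.
have GvE : source_loss Kstar J u v = 2^-1 * `|u| ^+ 2 + b
    + ('<(u + Kstar v), x> - (2^-1 * `|x| ^+ 2 + a)) - '<(u + Kstar v), u>.
  apply: EFin_inj; rewrite source_lossE// /bregman_loss.
  by rewrite (conjugate_half_sqnormE J_ge0 xv Jx) /half_sqnorm_plus Ju.
have := conjugate_half_sqnorm_le J_ge0 (Kstar w) xv Jx.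
have := source_lossE Kstar (v + w) J_ge0 Ju_lty.
rewrite /bregman_loss {1}/half_sqnorm_plus Ju linearD addrA GvE.
case: (conjugate _ _ _) => [c| |] //.
rewrite -!EFinD => -[->]; rewrite lee_fin !inner_expand; lra.
Qed.

End source_loss.

Theorem proposition3p3 (R : realType) (V : normedModType R) (Y Z : hilbertType R)
  (* X := dual V; the weak-star topology is metrisable on bounded sets *)
  (metr : forall B : set (dual V), bounded_set B ->
     metrizable_on R (B : set (weak_star V)))
  (* the operator on X, adjoint of a bounded linear operator Y -> V *)
  (KX : {linear dual V -> Y}) (KX_bd : bounded_op KX)
  (Kpre : {linear Y -> V}) (Kpre_bd : bounded_op Kpre)
  (KX_adj : forall (u : dual V) (y : Y), '<KX u, y> = u (Kpre y))
  (* the functional on X, nonnegative and a convex conjugate *)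
  (JX : dual V -> \bar R) (JX_ge0 : forall u, (0 <= JX u)%E)
  (JX_conj : exists F : V -> \bar R, proper_fun F /\
     forall u : dual V, JX u = conjugate (fun (f : dual V) x => f x) F u)
  (coercive : exists c : R -> R -> R -> R,
     (forall a a' b b' r r', a <= a' -> b <= b' -> r <= r' ->
        c a b r <= c a' b' r') /\
     (forall (f : Y) (a b : R) (u : dual V),
        `|KX u - f| <= a -> (JX u <= b%:E)%E -> `|u| <= c a b `|f|))
  (* continuous embedding of X into Z *)
  (iota : {linear dual V -> Z}) (iota_inj : injective iota)
  (iota_cont : continuous iota)
  (* extension of the operator to Z, and its Hilbert adjoint *)
  (K : {linear Z -> Y}) (K_bd : bounded_op K)
  (K_ext : forall u, K (iota u) = KX u)
  (Kstar : {linear Y -> Z}) (Kstar_bd : bounded_op Kstar)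
  (Kstar_adj : forall (z : Z) (y : Y), '<K z, y> = '<z, Kstar y>)
  (* extension of the functional to Z by +oo *)
  (J : Z -> \bar R) (J_ext : forall u, J (iota u) = JX u)
  (J_out : forall z, ~ range iota z -> J z = +oo%E)
  (J_proper : proper_fun J) (J_convex : convex_efun J)
  (J_lsc : lower_semicontinuous J)
  (udag : dual V) (udag_dom : (JX udag < +oo)%E) :
  let G := source_loss Kstar J (iota udag) in
  (* (i) *)
  (forall v : Y, subdifferential J (iota udag) (Kstar v) -> argmin G v) /\
  (* (ii) *)
  (forall v : Y, argmin G v ->
     K (iota udag) = K (prox J (iota udag + Kstar v))) /\
  ((forall z : Z, K z = 0 -> z = 0) ->
     forall v : Y, K (iota udag) = K (prox J (iota udag + Kstar v)) ->
       subdifferential J (iota udag) (Kstar v)).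
Proof.
move=> G.
have J_ge0 z : (0 <= J z)%E.
  have [[u _ <-]|zX] := pselect (range iota z); first by rewrite J_ext.
  by rewrite J_out// leey.
have Ju : (J (iota udag) < +oo)%E by rewrite J_ext.
have prox_min v := proxP J_ge0 J_convex (iota udag + Kstar v) J_proper J_lsc.
have prox_lty v := argmin_prox_lty J_ge0 J_proper (prox_min v).
have prox_sub v :=
  argmin_prox_subdifferential J_ge0 J_convex J_proper (prox_min v).
split; [|split].
- by move=> v uv w; rewrite /G source_loss_eq0// source_loss_ge0.
- move=> v v_min; set x := prox _ _.
  apply/esym/eqP; rewrite -subr_eq0 -linearB -normr_eq0 -sqrf_eq0 eq_le sqr_ge0.
  rewrite andbT -innerE; set d := K _.
  apply: (@ler_affine_right0 _ _ _ (2^-1 * `|Kstar d| ^+ 2)) => t /andP[t0 _].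
  have := source_loss_le J_ge0 Ju (- t *: d) (prox_lty v) (prox_sub v).
  move/(le_trans (v_min _)).
  (* Moving [Kstar] across the inner product turns the linear term into [- t * |d|^2]; one factor
     [t] is then cancelled. *)
  rewrite linearZ innerZl (innerC (Kstar d)) -Kstar_adj normrZ exprMn normrN.
  rewrite (gtr0_norm t0) -/d -/(G v) => G_le; rewrite -(ler_pM2l t0).
  by move: G_le; lra.
- move=> K_inj v Kx; have := prox_sub v.
  suff <- : iota udag = prox J (iota udag + Kstar v) by rewrite addrC addKr.
  by apply/eqP; rewrite -subr_eq0; apply/eqP/K_inj; rewrite linearB/= Kx subrr.
Qed.
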